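(* Fix an integer $n\ge 3$. There exist a constant $C=C(n)>0$ depending only on $n$ and an $H_0$ such that for all $H\ge H_0$, $$\frac{1}{N(H)}\sum_{a\in Q(H)}\ \max_{c\in\mathbb{Q}^n}\frac{\mathrm{Gap}(c,a)}{\|a\|_\infty^{1/(n-1)}\,\|c\|_1}\ge C .$$
   Context: For $H\ge 1$, $Q(H)$ is the set of $a=(a_1,\dots,a_n)^T\in\mathbb{Z}^n$ with all $a_i\neq0$, $\gcd(a_1,\dots,a_n)=1$ and $\|a\|_\infty\le H$; $N(H)$ is the cardinality of $Q(H)$. For $a\in\mathbb{Z}^n$, $b\in\mathbb{Z}$ let $P(a,b)=\{x\in\mathbb{R}^n_{\ge 0}: a^Tx=b\}$. For $c\in\mathbb{Q}^n$ let $IP(c,a,b)$ be the optimal value of the integer knapsack problem $\min\{c^Tx: x\in P(a,b)\cap\mathbb{Z}^n\}$ and $LP(c,a,b)$ the optimal value of its relaxation $\min\{c^Tx: x\in P(a,b)\}$. Set $IG(c,a,b)=IP(c,a,b)-LP(c,a,b)$ and $\mathrm{Gap}(c,a)=\max_b IG(c,a,b)$, where $b$ ranges over all integers such that the integer knapsack problem is feasible and bounded. The maximum over $c\in\mathbb{Q}^n$ is taken (as a supremum) over nonzero $c$ for which such $b$ exist. *)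

(* Defs.v *)
From HB Require Import structures.
From mathcomp Require Import all_boot all_order all_algebra.
From mathcomp Require Import all_classical all_reals all_analysis.
From mathcomp Require Import finmap zify.

Set Implicit Arguments.
Unset Strict Implicit.
Unset Printing Implicit Defensive.

Import Order.TTheory GRing.Theory Num.Theory.

Local Open Scope classical_set_scope.
Local Open Scope ring_scope.

Definition dot (R : realType) (n : nat) (u x : 'cV[R]_n) : R :=
  (u^T *m x) 0 0.

Definition normInf (n : nat) (a : 'cV[int]_n) : nat :=
  (\max_(i < n) `|(a i 0)%R|)%N.

Definition norm1 (n : nat) (c : 'cV[rat]_n) : rat := \sum_(i < n) `|c i 0|.

(* H ranges over the reals; integer heights are a special case. *)
Definition boxQ (R : realType) (n : nat) (H : R) : set 'cV[int]_n :=
  [set a : 'cV[int]_n |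
    [/\ forall i, a i 0 != 0,
        \big[gcdn/0%N]_(i < n) `|(a i 0)%R|%N = 1%N
      & (normInf a)%:R <= H]].
Arguments boxQ {R} n H.

Lemma finite_boxQ (R : realType) (n : nat) (H : R) : finite_set (boxQ n H).
Proof.
pose m := Num.truncn H.
pose f (g : {ffun 'I_n -> 'I_(m.*2.+1)}) : 'cV[int]_n :=
  \col_i ((g i : nat)%:Z - m%:Z).
apply: (@sub_finite_set _ _ (f @` setT)); last first.
  by apply: finite_image; exact: finite_finset.
move=> a [_ _ leH].
have lem : (normInf a <= m)%N.
  by rewrite /m truncn_ge_nat //; exact: le_trans leH.
have lei i : (`|(a i 0)%R| <= m)%N.
  by apply: leq_trans lem; rewrite /normInf; exact: (leq_bigmax i).
exists [ffun i => inord (absz (a i 0 + m%:Z)%R)] => //.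
apply/colP => i; rewrite mxE ffunE inordK; have := lei i; lia.
Qed.

Definition cardQ (R : realType) (n : nat) (H : R) : nat :=
  #|` fset_set (boxQ n H)|.
Arguments cardQ {R} n H.

Definition polyP (R : realType) (n : nat) (a : 'cV[int]_n) (b : int) :
    set 'cV[R]_n :=
  [set x : 'cV[R]_n | (forall i, 0 <= x i 0) /\ dot (map_mx intr a) x = b%:~R].
Arguments polyP R {n} a b.

Definition Zn (R : realType) (n : nat) : set 'cV[R]_n :=
  [set x : 'cV[R]_n | forall i, x i 0 \is a Num.int].
Arguments Zn : clear implicits.

Definition objective (R : realType) (n : nat) (c : 'cV[rat]_n) (x : 'cV[R]_n) : R :=
  dot (map_mx ratr c) x.

(* Optimal values are extended reals: +oo if infeasible, -oo if unbounded. *)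
Definition IP (R : realType) (n : nat) (c : 'cV[rat]_n) (a : 'cV[int]_n)
    (b : int) : \bar R :=
  ereal_inf [set (objective c x)%:E | x in polyP R a b `&` Zn R n].
Arguments IP R {n} c a b.

Definition LP (R : realType) (n : nat) (c : 'cV[rat]_n) (a : 'cV[int]_n)
    (b : int) : \bar R :=
  ereal_inf [set (objective c x)%:E | x in polyP R a b].
Arguments LP R {n} c a b.

Definition feasible_bounded (R : realType) (n : nat) (c : 'cV[rat]_n)
    (a : 'cV[int]_n) (b : int) : Prop :=
  polyP R a b `&` Zn R n !=set0 /\
  has_lbound [set objective c x | x in polyP R a b `&` Zn R n].
Arguments feasible_bounded R {n} c a b.

(* The data are rational, so LP is finite as soon as the integer problem is
   feasible and bounded; hence the difference is never of the form oo - oo on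
   the values of b over which Gap ranges. *)
Definition IG (R : realType) (n : nat) (c : 'cV[rat]_n) (a : 'cV[int]_n)
    (b : int) : \bar R :=
  (IP R c a b - LP R c a b)%E.
Arguments IG R {n} c a b.

Definition Gap (R : realType) (n : nat) (c : 'cV[rat]_n) (a : 'cV[int]_n) :
    \bar R :=
  ereal_sup [set IG R c a b | b in [set b | feasible_bounded R c a b]].
Arguments Gap R {n} c a.

Definition maxRatio (R : realType) (n : nat) (a : 'cV[int]_n) : \bar R :=
  ereal_sup
    [set (Gap R c a *
          (((normInf a)%:R `^ (n%:R - 1)^-1 * ratr (norm1 c))^-1)%:E)%E
    | c in [set c : 'cV[rat]_n |
             c != 0 /\ exists b, feasible_bounded R c a b]].
Arguments maxRatio R {n} a.

(* Main.v *)
(** Let [j] be an index with [|a_j| = A] maximal and take the cost [c] with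
    [c_j = 0] and [c_i = 1] for [i <> j].  There are only [s^(n-1)] vectors
    [y] in [{0, ..., s-1}^(n-1)], so if [s^(n-1) < A] some residue class [r]
    mod [A] is missed by [sum_(i <> j) a_i y_i].  As [gcd a = 1], some feasible
    [b = r mod A] has the sign of [a_j]; then [LP = 0], attained on the [j]-th
    axis, whereas every integer point costs at least [s], so [Gap(c,a) >= s].
    For [A >= 2] the best [s] is at least [A^(1/(n-1)) / 2].  The vectors with
    [A = 1] contribute nonnegatively and are at most half of [Q(H)] once
    [H >= 2], because doubling one entry embeds them into the others. *)
Require Import Defs.
From HB Require Import structures.
From mathcomp Require Import all_boot all_order all_algebra.
From mathcomp Require Import all_classical all_reals all_analysis.
From mathcomp Require Import finmap zify ring.

Set Implicit Arguments.
Unset Strict Implicit.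
Unset Printing Implicit Defensive.

Import Order.TTheory GRing.Theory Num.Theory.

Local Open Scope classical_set_scope.
Local Open Scope ring_scope.

(** * Residues of linear forms: pigeonhole and Bezout *)

Lemma missed_residue (m s A : nat) (w : 'I_m -> int) : (s ^ m < A)%N ->
  exists r : int, forall y : 'I_m -> nat, (forall i, (y i < s)%N) ->
    ~ (A%:Z %| (\sum_i w i * (y i)%:Z - r)%R)%Z.
Proof.
case: A => // A ltA.
pose val (g : {ffun 'I_m -> 'I_s}) : int := \sum_i w i * (g i : nat)%:Z.
pose res g : 'I_A.+1 := inord `|(val g %% A.+1%:Z)%Z|%N.
have [r rP] : exists r, r \notin codom res.
  apply/existsP; apply: contraLR ltA; rewrite negb_exists => /forallP all_res.
  have full : codom res =i predT.
    by move=> r; apply/negPn/(all_res r).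
  (* If every residue were hit, [A.+1] would be at most the number [s ^ m] of functions [g]. *)
  rewrite -leqNgt -[leqLHS](card_ord A.+1) -(eq_card full).
  by apply: leq_trans (leq_image_card _ _) _; rewrite card_ffun !card_ord.
exists (r : nat)%:Z => y lty dvd_r; move/negP: rP; apply; apply/codomP.
exists [ffun i => Ordinal (lty i)].
have -> : res [ffun i => Ordinal (lty i)] = inord `|((r : nat)%:Z %% A.+1%:Z)%Z|%N.
  congr (inord (absz _)); apply/eqP; rewrite eqz_mod_dvd /val.
  by under eq_bigr do rewrite ffunE.
by rewrite modz_nat absz_nat modn_small ?ltn_ord // inord_val.
Qed.

(** Induction on [n]: a two-term Bezout identity joins the head entry to the gcd of the tail, whose
    coefficients are rescaled by [v]. *)
Lemma bezout_big (n : nat) (a : 'I_n -> int) :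
  exists z : 'I_n -> int,
    \sum_i a i * z i = (\big[gcdn/0%N]_(i < n) `|a i|%N)%:Z.
Proof.
elim: n a => [|n IHn] a; first by exists (fun=> 0); rewrite !big_ord0.
have [z zE] := IHn (fun i => a (lift ord0 i)).
set g := \big[_/_]_(i < n) _ in zE.
have [u [v uvE]] := Bezoutz (a ord0) g.
exists (fun i => if unlift ord0 i is Some k then v * z k else u).
rewrite !big_ord_recl unlift_none /=.
under eq_bigr do rewrite liftK mulrCA.
by rewrite -mulr_sumr zE mulrC uvE.
Qed.

Lemma normInf_attained (n : nat) (a : 'cV[int]_n.+1) :
  exists j, `|(a j 0)%R|%N = normInf a.
Proof.
have I_gt0 : (0 < #|'I_n.+1|)%N by rewrite card_ord.
by have [j jE] := @bigop.eq_bigmax _ (fun i => `|(a i 0)%R|%N) I_gt0; exists j.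
Qed.

Lemma leq_normInf (n : nat) (a : 'cV[int]_n) i : (`|(a i 0)%R|%N <= normInf a)%N.
Proof. by rewrite /normInf (@bigop.leq_bigmax _ _ i). Qed.

Lemma dotE (R : realType) (n : nat) (u x : 'cV[R]_n) :
  dot u x = \sum_i u i 0 * x i 0.
Proof. by rewrite /dot mxE; apply: eq_bigr => i _; rewrite mxE. Qed.

(** * Costs and right-hand sides that force a large gap *)

Definition coaxis_cost (m : nat) (j : 'I_m.+1) : 'cV[rat]_m.+1 :=
  \col_i (i != j)%:R.

Lemma norm1_coaxis_cost (m : nat) (j : 'I_m.+1) : norm1 (coaxis_cost j) = m%:R.
Proof.
rewrite /norm1 (bigD1_ord j) //= mxE eqxx normr0 add0r.
under eq_bigr do rewrite mxE eq_sym neq_lift normr1.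
by rewrite sumr_const card_ord.
Qed.

Lemma objective_coaxis_cost (R : realType) (m : nat) (j : 'I_m.+1) (x : 'cV[R]_m.+1) :
  objective (coaxis_cost j) x = \sum_i x (lift j i) 0.
Proof.
rewrite /objective dotE (bigD1_ord j) //= !mxE eqxx rmorph0 mul0r add0r.
by apply: eq_bigr => i _; rewrite !mxE eq_sym neq_lift rmorph1 mul1r.
Qed.

(** Scale Bezout coefficients by [r] and reduce those off [j] modulo [a j 0], which makes them
    nonnegative. The coordinate at [j] does not affect the residue, so it is free to fix the
    sign. *)
Lemma reachable_residue (m : nat) (a : 'cV[int]_m.+1) (j : 'I_m.+1) (r : int) :
  a j 0 != 0 -> \big[gcdn/0%N]_(i < m.+1) `|(a i 0)%R|%N = 1%N ->
  exists x : 'cV[int]_m.+1, [/\ forall i, 0 <= x i 0,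
    ((a j 0)%R %| (\sum_i a i 0 * x i 0 - r)%R)%Z &
    0 <= a j 0 * (\sum_i a i 0 * x i 0)].
Proof.
move=> aj0 gcd1; have [z zE] := bezout_big (fun i => a i 0).
rewrite {}gcd1 in zE; have {}zE : \sum_i a i 0 * z i = 1 := zE.
pose y i := ((r * z (lift j i)) %% (a j 0)%R)%Z.
have y0 i : 0 <= y i by rewrite modz_ge0.
pose T := \sum_i a (lift j i) 0 * y i.
(* The total becomes [a j 0 * |T| + T]; as [|a j 0| >= 1], the first term dominates and sets the
   sign. *)
exists (\col_i if unlift j i is Some k then y k else `|T|).
have sumE : \sum_i a i 0 * (\col_i if unlift j i is Some k then y k else `|T|) i 0
    = a j 0 * `|T| + T.
  rewrite (bigD1_ord j) //= mxE unlift_none; congr (_ + _).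
  by apply: eq_bigr => i _; rewrite mxE liftK.
rewrite sumE; split.
- by move=> i; rewrite mxE; case: unliftP.
- rewrite -[r]mulr1 -zE (bigD1_ord j) //= mulrDr opprD addrACA.
  rewrite rpredD //; first by rewrite mulrCA -mulrBr dvdz_mulr.
  rewrite mulr_sumr -sumrB rpred_sum // => i _.
  rewrite mulrCA -mulrBr dvdz_mull // /y.
  by rewrite {2}(divz_eq (r * z (lift j i)) (a j 0)) opprD addrCA subrr addr0 rpredN dvdz_mull.
- nia.
Qed.

(** The parameter [s] stays free: [s = 0] later gives nonnegativity, and [s] close to the [m]-th
    root of [normInf a] gives the constant. *)
Lemma maxRatio_ge (R : realType) (m s : nat) (a : 'cV[int]_m.+1) :
  (0 < m)%N -> (forall i, a i 0 != 0) ->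
  \big[gcdn/0%N]_(i < m.+1) `|(a i 0)%R|%N = 1%N -> (s ^ m < normInf a)%N ->
  ((s%:R / ((normInf a)%:R `^ m%:R^-1 * m%:R))%:E <= maxRatio R a)%E.
Proof.
move=> m0 a0 gcd1 lts; have [j jE] := normInf_attained a.
have [r rP] := @missed_residue m _ _ (fun i => a (lift j i) 0) lts.
have [x0 [x0_ge0 dvd_x0 sgn_x0]] := reachable_residue r (a0 j) gcd1.
pose c := coaxis_cost j.
set b : int := \sum_i _ in dvd_x0 sgn_x0.
have obj_ge (x : 'cV[R]_m.+1) : (Defs.polyP R a b `&` Zn R m.+1) x -> s%:R <= objective c x.
  move=> [[x_ge0 xE] x_int]; rewrite objective_coaxis_cost leNgt; apply/negP => lt_s.
  have xnat i : exists k : nat, x i 0 = k%:R.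
    by apply/natrP; rewrite natrEint x_int x_ge0.
  have [k kE] := choice xnat.
  have sum_lt : (\sum_i k (lift j i) < s)%N.
    rewrite -(ltr_nat R) natr_sum; apply: le_lt_trans lt_s.
    by apply: ler_sum => i _; rewrite kE.
  (* The cost is a sum of natural numbers, so each coordinate off [j] is below [s]; together they
     would produce the missed residue [r]. *)
  apply: (rP (fun i => k (lift j i))) => [i|].
    by apply: leq_ltn_trans sum_lt; rewrite (bigD1 i) //= leq_addr.
  have bE : b = a j 0 * (k j)%:Z + \sum_i a (lift j i) 0 * (k (lift j i))%:Z.
    rewrite -(bigD1_ord j (P := xpredT) (F := fun i => a i 0 * (k i)%:Z)) //.
    apply: (@intr_inj R); rewrite -xE dotE rmorph_sum.
    by apply: eq_bigr => i _; rewrite mxE kE rmorphM.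
  rewrite -jE dvdzE absz_nat -dvdzE.
  have -> : \sum_i a (lift j i) 0 * (k (lift j i))%:Z - r =
    (b - r) - a j 0 * (k j)%:Z by rewrite bE; ring.
  by rewrite rpredB ?dvdz_mulr.
have feas : feasible_bounded R c a b.
  split.
    exists (map_mx intr x0); split; last by move=> i; rewrite mxE intr_int.
    split; first by move=> i; rewrite mxE ler0z.
    rewrite dotE rmorph_sum; apply: eq_bigr => i _.
    by rewrite !mxE rmorphM.
  by exists s%:R => _ [x xP <-]; exact: obj_ge.
have gap_ge : (s%:R%:E <= Gap R c a)%E.
  apply: (@le_trans _ _ (IG R c a b)); last first.
    by apply: ereal_sup_ubound; exists b.
  (* It suffices that [s <= IP] and [LP <= 0]; the latter is witnessed by a point of the [j]-th
     axis, where the cost vanishes. *)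
  rewrite /IG -[leLHS]sube0; apply: leeB.
    by apply/ereal_infP => _ [x xP <-]; rewrite lee_fin obj_ge.
  apply: ereal_inf_lbound; exists (\col_i if i == j then b%:~R / (a j 0)%:~R else 0).
    split.
      move=> i; rewrite mxE; case: eqP => // _.
      (* This form exposes the product [a j 0 * b], nonnegative by [sgn_x0]. *)
      have -> : b%:~R / (a j 0)%:~R = (a j 0 * b)%:~R / (a j 0)%:~R ^+ 2 :> R.
        by rewrite rmorphM; field; rewrite intr_eq0.
      by rewrite divr_ge0 ?sqr_ge0 // ler0z.
    rewrite dotE (bigD1_ord j) //= !mxE eqxx big1 ?addr0.
      by rewrite mulrC divfK // intr_eq0.
    by move=> i _; rewrite !mxE eq_sym (negbTE (neq_lift _ _)) mulr0.
  rewrite objective_coaxis_cost big1 // => i _.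
  by rewrite mxE eq_sym (negbTE (neq_lift _ _)).
apply: (@le_trans _ _ (Gap R c a *
    (((normInf a)%:R `^ (m.+1%:R - 1)^-1 * ratr (norm1 c))^-1)%:E)%E); last first.
  apply: ereal_sup_ubound; exists c => //; split; last by exists b.
  apply/eqP => c0; have := norm1_coaxis_cost j; rewrite -/c c0 /norm1 big1.
    by move/eqP; rewrite eq_sym pnatr_eq0 -leqn0 leqNgt m0.
  by move=> i _; rewrite mxE normr0.
rewrite norm1_coaxis_cost ratr_nat -natr1 addrK EFinM.
by apply: lee_wpmul2r.
Qed.

(** Let [s + 1] be the least [t] with [A <= t ^ m]. Since [A > 1], [s >= 1], hence
    [s + 1 <= 2 * s]. *)
Lemma root_bracket (m A : nat) : (0 < m)%N -> (1 < A)%N ->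
  exists2 s, (s ^ m < A)%N & (A <= s.*2 ^ m)%N.
Proof.
move=> m0 A1.
have ex : exists t, (A <= t ^ m)%N.
  by exists A; rewrite -{1}(expn1 A) leq_exp2l.
case: (ex_minnP ex) => -[|[|s]] leA minA.
- by move: leA; rewrite exp0n // leqNgt (ltn_trans _ A1).
- by move: leA; rewrite exp1n leqNgt A1.
exists s.+1; first by rewrite ltnNge; apply/negP => /minA; rewrite ltnn.
by apply: leq_trans leA _; rewrite leq_exp2r //; lia.
Qed.

Lemma maxRatio_ge0 (R : realType) (m : nat) (H : R) (a : 'cV[int]_m.+1) :
  (0 < m)%N -> boxQ m.+1 H a -> (0 <= maxRatio R a)%E.
Proof.
move=> m0 [a0 gcd1 _]; have := @maxRatio_ge R m 0 a m0 a0 gcd1.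
rewrite mul0r exp0n //; apply.
by apply: leq_trans (leq_normInf a ord0); rewrite absz_gt0.
Qed.

(** With [A = normInf a], the bracket [A <= (2 * s) ^ m] bounds the [m]-th root of [A] by [2 * s],
    so [s] cancels in the ratio. *)
Lemma maxRatio_ge_const (R : realType) (m : nat) (H : R) (a : 'cV[int]_m.+1) :
  (0 < m)%N -> boxQ m.+1 H a -> (1 < normInf a)%N ->
  (((m.*2)%:R^-1)%:E <= maxRatio R a)%E.
Proof.
move=> m0 [a0 gcd1 _] A1; have [s lts leA] := root_bracket m0 A1.
apply: le_trans (maxRatio_ge R m0 a0 gcd1 lts); rewrite lee_fin.
have A0 : 0 < (normInf a)%:R `^ m%:R^-1 :> R by rewrite powR_gt0 // ltr0n ltnW.
have mR : 0 < m%:R :> R by rewrite ltr0n.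
have root_le : (normInf a)%:R `^ m%:R^-1 <= s.*2%:R :> R.
  have -> : s.*2%:R = (s.*2 ^ m)%:R `^ m%:R^-1 :> R.
    by rewrite natrX -powR_mulrn // -powRrM mulfV ?powRr1 // gt_eqF.
  by rewrite ge0_ler_powR // ?nnegrE ?invr_ge0 // ler_nat.
have mR2 : 0 < m.*2%:R :> R by rewrite ltr0n double_gt0.
rewrite ler_pdivlMr ?mulr_gt0 // mulrC ler_pdivrMr //.
by rewrite -mul2n natrM mulrA -[s%:R * 2]natrM muln2 ler_pM2r.
Qed.

(** * Counting the vectors of norm one against the others *)

Definition double_head (m : nat) (a : 'cV[int]_m.+1) : 'cV[int]_m.+1 :=
  \col_i (if i == ord0 then 2 * a i 0 else a i 0).

Lemma double_head_inj (m : nat) : injective (@double_head m).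
Proof.
move=> a b /colP eq_ab; apply/colP => i; have := eq_ab i; rewrite !mxE.
by case: eqP => // _; lia.
Qed.

(** All entries of [a] are [1] or [-1]. As [m > 0], the last one escapes the doubling and keeps the
    gcd at [1]; [2 <= H] leaves room for the doubled one. *)
Lemma double_head_boxQ (R : realType) (m : nat) (H : R) (a : 'cV[int]_m.+1) :
  (0 < m)%N -> 2 <= H -> boxQ m.+1 H a -> (normInf a <= 1)%N ->
  boxQ m.+1 H (double_head a) /\ (1 < normInf (double_head a))%N.
Proof.
move=> m0 H2 [a0 _ _] a1.
have absa i : `|(a i 0)%R|%N = 1%N.
  by have := leq_trans (leq_normInf a i) a1; have := a0 i; lia.
split; first split.
- by move=> i; rewrite mxE; have := a0 i; case: ifP; lia.
- apply/eqP; rewrite -dvdn1 -[X in (_ %| X)%N](absa ord_max).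
  have -> : a ord_max 0 = double_head a ord_max 0.
    by rewrite mxE; case: eqP => // /(congr1 val) /=; lia.
  exact: (@biggcdn_inf _ ord_max).
- apply: le_trans H2; rewrite (ler_nat _ _ 2); apply/bigmax_leqP => i _.
  by rewrite mxE; have := absa i; case: ifP; lia.
- apply: leq_trans (leq_normInf _ ord0); rewrite mxE eqxx; have := absa ord0; lia.
Qed.

Lemma cardQ_gt0 (R : realType) (n : nat) (H : R) :
  (0 < n)%N -> 1 <= H -> (0 < cardQ n H)%N.
Proof.
case: n => // n _ H1; rewrite cardfs_gt0; apply/fset0Pn; exists (const_mx 1).
rewrite (in_fset_set (finite_boxQ _ _)).
apply/mem_set; split.
- by move=> i; rewrite mxE.
- by apply/eqP; rewrite -dvdn1; apply: (@biggcdn_inf _ ord0); rewrite ?mxE.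
- by apply: le_trans H1; rewrite (ler_nat _ _ 1); apply/bigmax_leqP => i _; rewrite mxE.
Qed.

Lemma cardQ_le_double (R : realType) (m : nat) (H : R) : (0 < m)%N -> 2 <= H ->
  (cardQ m.+1 H <=
   (count (fun a => 1 < normInf a) (fset_set (boxQ m.+1 H))).*2)%N.
Proof.
move=> m0 H2; set Q := fset_set _; rewrite /cardQ -/Q.
pose big := [pred a : 'cV[int]_m.+1 | (1 < normInf a)%N].
rewrite -(count_predC big) -addnn leq_add2l -!size_filter.
(* Only the vectors of norm at most one remain to be bounded; their images are distinct and lie
   among the others. *)
rewrite -(size_map (@double_head m)); apply: uniq_leq_size.
  by rewrite (map_inj_uniq (@double_head_inj m)) filter_uniq // fset_uniq.
move=> _ /mapP[a + ->]; rewrite !mem_filter /= -leqNgt => /andP[a1].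
rewrite !(in_fset_set (finite_boxQ _ _)).
by move=> /set_mem aQ; have [? ->] := double_head_boxQ m0 H2 aQ a1; apply/mem_set.
Qed.

Theorem theorem4 (R : realType) (n : nat) (hn : (3 <= n)%N) :
  exists C : R, 0 < C /\
  exists H0 : R, forall H : R, H0 <= H ->
    (C%:E <= ((cardQ n H)%:R^-1)%:E * \sum_(a \in boxQ n H) maxRatio R a)%E.
Proof.
case: n hn => // m hm; have m0 : (0 < m)%N by lia.
have mR : 0 < m%:R :> R by rewrite ltr0n.
(* The first factor is the bound for norm above one, and [1 / 2] is the guaranteed proportion of
   such vectors. *)
exists ((m.*2)%:R^-1 / 2); split.
  by rewrite divr_gt0 // invr_gt0 ltr0n; lia.
exists 2 => H H2.
have N0 : 0 < (cardQ m.+1 H)%:R :> R.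
  by rewrite ltr0n cardQ_gt0 //; apply: le_trans H2; rewrite ler1n.
have finQ := finite_boxQ m.+1 H.
rewrite fsbig_finite //=; set Q := fset_set _.
pose big := [pred a : 'cV[int]_m.+1 | (1 < normInf a)%N].
apply: (@le_trans _ _ (((cardQ m.+1 H)%:R^-1)%:E *
  (\sum_(a <- Q) (if big a then (m.*2)%:R^-1 else 0))%:E)%E).
  have := cardQ_le_double m0 H2; rewrite -(ler_nat R) -muln2 natrM => leN.
  rewrite -big_mkcond big_const_seq iter_addr_0 -EFinM lee_fin.
  rewrite [leRHS]mulrC ler_pdivlMr //.
  rewrite -[leRHS]mulr_natr -mulrA ler_wpM2l ?invr_ge0 //.
  by rewrite mulrC ler_pdivrMr.
apply: lee_wpmul2l; first by rewrite lee_fin invr_ge0 ltW.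
rewrite -sumEFin !big_seq; apply: lee_sum => a.
rewrite in_fset_set // => /set_mem aQ.
case: ifP => [a1|_]; first exact: maxRatio_ge_const aQ a1.
exact: maxRatio_ge0 aQ.
Qed.
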